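(* Let $F,f,g_1,\ldots,g_k$ be real polynomials satisfying the following conditions. (a) $F(x)=a(x)f(x)+b_1(x)g_1(x)+\cdots+b_k(x)g_k(x)$, where $a(x),b_1(x),\ldots,b_k(x)$ are real polynomials, such that $\deg F=\deg f$ or $\deg F=\deg f+1$. (b) $f,g_j\in\mathrm{RZ}$ and $g_j\preceq f$ for each $j$. (c) $F$ and $g_1,\ldots,g_k$ have leading coefficients of the same sign. Suppose that $b_j(r)\le 0$ for each $j$ and each zero $r$ of $f$. Then $F\in\mathrm{RZ}$ and $f\preceq F$. In particular, if for each zero $r$ of $f$ there is an index $j$ such that $g_j\prec f$ and $b_j(r)<0$, then $f\prec F$.
   Context: $\mathrm{RZ}$ denotes the set of real polynomials with only real zeros. For $f,g\in\mathrm{RZ}$, let $\{r_i\}$ and $\{s_j\}$ be all zeros (with multiplicity) of $f$ and $g$ respectively, in nonincreasing order. We say $g$ alternates left of $f$ (''$g$ alternates $f$'') if $\deg f=\deg g=n$ and $s_n\le r_n\le s_{n-1}\le\cdots\le s_2\le r_2\le s_1\le r_1$. We say $g$ interlaces $f$ if $\deg f=\deg g+1=n$ and $r_n\le s_{n-1}\le\cdots\le s_2\le r_2\le s_1\le r_1$. Write $g\preceq f$ for ''either $g$ alternates $f$ or $g$ interlaces $f$''. If no equality sign occurs in the respective chain of inequalities, $g$ strictly alternates (resp. strictly interlaces) $f$; write $g\prec f$ for ''either $g$ strictly alternates $f$ or $g$ strictly interlaces $f$''. By convention, $a\preceq bx+c$ for any real constants $a,b,c$, and $f\preceq 0$, $0\preceq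 f$ for any real polynomial $f$ with only real zeros. *)

(* Defs.v *)
From mathcomp Require Import all_boot all_order all_algebra.
From mathcomp Require Import complex reals.

Set Implicit Arguments.
Unset Strict Implicit.
Unset Printing Implicit Defensive.

Import Order.TTheory GRing.Theory Num.Theory.
Local Open Scope ring_scope.

(* The zero polynomial is admitted in RZ: the conventions f <= 0 and 0 <= f
   (see [preceq]) presuppose it. *)
Definition RZ (R : realType) (p : {poly R}) : Prop :=
  p != 0 ->
  forall z : complex R, root (map_poly (real_complex R) p) z -> complex.Im z = 0.

(* Meaningful for p != 0 only, since [mup] takes a default value at 0. *)
Definition zeros_of (R : realType) (p : {poly R}) (s : seq R) : Prop :=
  sorted >=%R s /\ forall x : R, count_mem x s = mup x p.

(* With lt := <=%R and 0-based indices this is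
     ... <= s_1 <= r_1 <= s_0 <= r_0 ;
   the chain ends on s if size r = size s and on r if size r = size s + 1. *)
Definition chain (R : realType) (lt : rel R) (s r : seq R) : Prop :=
  (forall i, (i < size s)%N -> lt s`_i r`_i) /\
  (forall i, (i.+1 < size r)%N -> lt r`_i.+1 s`_i).

Definition chained_zeros (R : realType) (lt : rel R) (g f : {poly R}) : Prop :=
  [/\ RZ g, RZ f, g != 0, f != 0 &
      exists s r : seq R, [/\ zeros_of g s, zeros_of f r & chain lt s r]].

Definition alternates (R : realType) (g f : {poly R}) : Prop :=
  size f = size g /\ chained_zeros <=%R g f.

Definition interlaces (R : realType) (g f : {poly R}) : Prop :=
  size f = (size g).+1 /\ chained_zeros <=%R g f.

Definition strictly_alternates (R : realType) (g f : {poly R}) : Prop :=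
  size f = size g /\ chained_zeros <%R g f.

Definition strictly_interlaces (R : realType) (g f : {poly R}) : Prop :=
  size f = (size g).+1 /\ chained_zeros <%R g f.

Inductive preceq (R : realType) (g f : {poly R}) : Prop :=
| Preceq_alternates of alternates g f
| Preceq_interlaces of interlaces g f
| Preceq_linear (a b c : R) of g = a%:P & f = b *: 'X + c%:P
| Preceq_zero_right of RZ g & f = 0
| Preceq_zero_left of g = 0 & RZ f.

Definition prec (R : realType) (g f : {poly R}) : Prop :=
  strictly_alternates g f \/ strictly_interlaces g f.

(* The zero polynomial, having no leading coefficient, is not constrained. *)
Definition same_lead_sign (R : realType) (ps : seq {poly R}) : Prop :=
  {in ps &, forall p q, p != 0 -> q != 0 ->
     Num.sg (lead_coef p) = Num.sg (lead_coef q)}.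

(* Main.v *)
Require Import Defs.
From mathcomp Require Import all_boot all_order all_algebra.
From mathcomp Require Import complex reals.
From mathcomp Require Import zify lra.

Import Order.TTheory GRing.Theory Num.Theory.
Local Open Scope ring_scope.

(** Take the leading coefficients of [F] and the [g j] positive. At a zero [x]
    of [f], interlacing forces each [g j], if nonzero at [x], to have the sign
    of (-1)^m there, [m] being the number of zeros of [f] beyond [x]; hence [F]
    has the opposite sign, weakly. When [f] has simple zeros this alternation
    locates the zeros of [F] by the intermediate value theorem. A multiple zero
    of [f] is a zero of every [g j], hence of [F], and can be divided out. Under
    the strict hypothesis [F] does not vanish at any zero of [f], so no equality
    occurs in the chain. *)

Local Notation prodX s := (\prod_(z <- s) ('X - z%:P)).

(** * Interlacing of lists through counts on up-closed sets *)

Definition up_closed {R : realFieldType} (P : pred R) :=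
  forall x y, x <= y -> P x -> P y.

(* For nonincreasing lists this is [chain <=%R s r] together with
   [size s <= size r <= size s + 1]; unlike [chain] it ignores the order of the
   lists, so a common element can be added or removed. *)
Definition weave {R : realFieldType} (s r : seq R) :=
  forall P, up_closed P -> (count P s <= count P r <= (count P s).+1)%N.

Definition ge_than {R : realFieldType} (x : R) : pred R := fun y => x <= y.

Definition gt_than {R : realFieldType} (x : R) : pred R := fun y => x < y.

Lemma up_closed_ge {R : realFieldType} (x : R) : up_closed (ge_than x).
Proof. by rewrite /ge_than; move=> y z yz xy; apply: le_trans yz. Qed.

Lemma up_closed_gt {R : realFieldType} (x : R) : up_closed (gt_than x).
Proof. by rewrite /gt_than; move=> y z yz xy; apply: lt_le_trans yz. Qed.

Lemma count_ge {R : realFieldType} (x : R) (s : seq R) :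
  count (ge_than x) s = (count (gt_than x) s + count_mem x s)%N.
Proof.
rewrite /ge_than /gt_than; elim: s => //= y s ->; rewrite le_eqVlt eq_sym; case: eqP => [->|_] /=.
  by rewrite ltxx; lia.
by case: (x < y); lia.
Qed.

Lemma weavexx {R : realFieldType} (s : seq R) : weave s s.
Proof. by move=> P _; rewrite leqnn /=. Qed.

Lemma weave_nil {R : realFieldType} (r : seq R) : (size r <= 1)%N -> weave [::] r.
Proof. by move=> ? P _ /=; have := count_size P r; lia. Qed.

Lemma weave_size {R : realFieldType} (s r : seq R) :
  weave s r -> (size s <= size r <= (size s).+1)%N.
Proof. by move/(_ predT); rewrite !count_predT; apply. Qed.

Lemma perm_weave {R : realFieldType} (s s' r r' : seq R) :
  perm_eq s s' -> perm_eq r r' -> weave s r -> weave s' r'.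
Proof. by move=> /permP es /permP er w P /w; rewrite es er. Qed.

Lemma weave_cons {R : realFieldType} (x : R) (s r : seq R) :
  weave (x :: s) (x :: r) <-> weave s r.
Proof. by split=> w P /w /=; lia. Qed.

Lemma weave_rem {R : realFieldType} (x : R) (s r : seq R) :
  x \in s -> x \in r -> weave s r -> weave (rem x s) (rem x r).
Proof.
move=> xs xr w; apply/(weave_cons x).
by apply: perm_weave w; apply: perm_to_rem.
Qed.

(** Both rays at [x] are tested: passing from the open to the closed one leaves the count of [s]
    unchanged and raises that of [r] by the multiplicity of [x], while the excess of [r] over [s]
    must stay in {0, 1}. The first conclusion fixes signs at [x]; the second forces a multiple
    element of [r] to occur in [s]. *)
Lemma weave_notin {R : realFieldType} (s r : seq R) (x : R) :
  weave s r -> x \in r -> x \notin s ->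
  count (gt_than x) s = count (gt_than x) r /\ count_mem x r = 1%N.
Proof.
move=> w; rewrite -!has_pred1 !has_count -leqNgt => xr xs.
have := w _ (up_closed_ge x); have := w _ (up_closed_gt x).
by rewrite !count_ge; lia.
Qed.

(** In a nonincreasing list the elements of an up-closed set form an initial segment, and the count
    is its length. This converts counts into indices. *)
Lemma sorted_count {R : realFieldType} (P : pred R) (s : seq R) (i : nat) :
  up_closed P -> sorted >=%R s ->
  (i < count P s)%N = (i < size s)%N && P s`_i.
Proof.
move=> upP; elim: s i => [|x s IHs] i //= xs.
have sa : all (fun y => y <= x) s.
  by move: xs; rewrite path_sortedE; [case/andP | exact: ge_trans].
have {}IHs i := IHs i (path_sorted xs).
case: i => [|i] /=; last first.
  case Px: (P x); first by rewrite add1n ltnS IHs.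
  have -> : count P s = 0%N.
    apply/eqP; rewrite -leqn0 leqNgt -has_count; apply/hasP => -[y ys Py].
    by move: Px; rewrite (upP y) // (allP sa).
  apply/esym/negP => /andP[] hi Pi.
  by move: Px; rewrite (upP _ _ _ Pi) // (allP sa) // mem_nth.
case Px: (P x) => //=.
rewrite add0n; apply/negP; rewrite -has_count => /hasP[y ys Py].
by move: Px; rewrite (upP y) // (allP sa).
Qed.

(** If a bound on counts failed, let [i] be the smaller count, [count P r] or [count P s]. The other
    list has its entry of index [i], respectively [i.+1], in [P]; the chain then puts entry [i] of
    the first list in [P], contradicting [sorted_count]. *)
Lemma chain_weave {R : realType} (s r : seq R) :
  sorted >=%R s -> sorted >=%R r -> (size s <= size r <= (size s).+1)%N ->
  chain <=%R s r -> weave s r.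
Proof.
move=> ss sr /andP[sz1 sz2] [c1 c2] P upP; apply/andP; split.
  rewrite leqNgt; apply/negP => h.
  have : (count P r < count P s)%N by [].
  rewrite (sorted_count P) // => /andP[hi Pi].
  have : (count P r < count P r)%N; last by rewrite ltnn.
  by rewrite [X in is_true X](sorted_count P) // (upP _ _ (c1 _ hi)) // andbT (leq_trans hi).
rewrite leqNgt; apply/negP; rewrite (sorted_count P) // => /andP[hi Pi].
have : (count P s < count P s)%N; last by rewrite ltnn.
by rewrite [X in is_true X](sorted_count P) // (upP _ _ (c2 _ hi)) // andbT -ltnS (leq_trans hi).
Qed.

(** It suffices to test the closed rays that start at the smaller side of each desired
    inequality. *)
Lemma weave_chain {R : realType} (s r : seq R) :
  sorted >=%R s -> sorted >=%R r -> weave s r -> chain <=%R s r.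
Proof.
move=> ss sr w; split=> i hi.
  have /andP[h _] := w _ (up_closed_ge s`_i).
  have : (i < count (ge_than s`_i) s)%N.
    by rewrite (sorted_count _ s) ?hi ?/ge_than ?lexx //; exact: up_closed_ge.
  move=> /leq_trans /(_ h); rewrite (sorted_count _ r) //; last exact: up_closed_ge.
  by case/andP.
have /andP[_ h] := w _ (up_closed_ge r`_i.+1).
have : (i.+1 < count (ge_than r`_i.+1) r)%N.
  by rewrite (sorted_count _ r) ?hi ?/ge_than ?lexx //; exact: up_closed_ge.
move=> /leq_trans /(_ h); rewrite ltnS (sorted_count _ s) //; last exact: up_closed_ge.
by case/andP.
Qed.

(** Let a common element have index [i] in [s] and [j] in [r]. If [j <= i], then [s_i < r_i <= r_j];
    otherwise [r_j <= r_(i+1) < s_i]. *)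
Lemma strict_chain_notin {R : realType} (s r : seq R) (x : R) :
  sorted >=%R s -> sorted >=%R r -> (size s <= size r)%N ->
  chain <%R s r -> x \in r -> x \notin s.
Proof.
move=> ss sr sz [c1 c2] xr; apply/negP => xs.
move: (nth_index 0 xs) (nth_index 0 xr).
rewrite -index_mem in xs; rewrite -index_mem in xr.
set i := index x s in xs *; set j := index x r in xr * => ei ej.
have mono m n : (m <= n)%N -> (n < size r)%N -> r`_n <= r`_m.
  move=> mn nr; apply: (sorted_leq_nth ge_trans ge_refl 0 sr) => //.
  exact: leq_ltn_trans mn nr.
case: (leqP j i) => ij.
  by have := c1 i xs; rewrite ei -ej ltNge mono // (leq_trans xs).
have ir := leq_ltn_trans ij xr.
by have := c2 i ir; rewrite ei -ej ltNge mono.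
Qed.

(** * Locating zeros from alternating signs *)

Lemma sign_prodX {R : realFieldType} (s : seq R) (x : R) : x \notin s ->
  0 < (-1) ^+ count (gt_than x) s * (prodX s).[x].
Proof.
elim: s => [|y s IHs]; first by rewrite big_nil hornerC /= mulr1 ltr01.
rewrite inE negb_or big_cons hornerM hornerXsubC /= {1}/gt_than => /andP[xy] /IHs; move: xy.
case: (ltgtP x y) => //= yx _ IH; first by rewrite add1n exprS; nra.
by rewrite add0n; nra.
Qed.

Lemma monic_root_ge {R : rcfType} (p : {poly R}) (x : R) :
  p \is monic -> p.[x] <= 0 -> exists2 y, x <= y & root p y.
Proof.
move=> /monic_Cauchy_bound[c hc] px.
have [y /andP[xy _] py] : exists2 y, x <= y <= Num.max x c & root p y.
  by apply: poly_ivt; rewrite ?le_max ?lexx // px ltW // hc // le_max lexx orbT.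
by exists y.
Qed.

(** Induction on the nodes, largest first: at the largest node [x] the monic [F] is nonpositive, so
    it has a root [z >= x]. Each remaining node [y] satisfies [y < x <= z], so the negative factor
    [y - z] compensates for the loss of [x] in the count. *)
Lemma alternating_signs_weave {R : rcfType} (r : seq R) (F : {poly R}) :
  F \is monic -> sorted >%R r ->
  size F = (size r).+1 \/ size F = (size r).+2 ->
  {in r, forall x, (-1) ^+ count (gt_than x) r * F.[x] <= 0} ->
  exists2 t, F = prodX t & weave r t.
Proof.
elim: r F => [|x r IHr] F monF /=.
  move=> _ [] szF _.
    exists [::] => //; rewrite big_nil; apply/polyP => -[|i]; rewrite !coefE.
      by move/monicP: monF; rewrite lead_coefE szF.
    by rewrite nth_default // szF.
  have [y Fy] : exists y, F = 'X - y%:P.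
    exists (- F`_0); apply/polyP => -[|[|i]]; rewrite !(coefE, coefN) /=.
    - by rewrite sub0r opprK.
    - by move/monicP: monF; rewrite lead_coefE szF /= subr0.
    - by rewrite nth_default ?subr0 // szF.
  by exists [:: y]; [rewrite big_seq1 | apply: weave_nil].
move=> xr szF sgn.
have rx : {in r, forall y, y < x}.
  by move: xr; rewrite path_sortedE; [case/andP => /allP | exact: rev_trans lt_trans].
have Fx : F.[x] <= 0.
  have := sgn x (mem_head _ _); rewrite /= {1}/gt_than ltxx add0n.
  suff -> : count (gt_than x) r = 0%N by rewrite mul1r.
  rewrite -[LHS](@eq_in_count _ pred0) ?count_pred0 // => y /rx yx.
  by rewrite /gt_than lt_gtF.
(* The root is chosen to be [x] itself whenever [F] vanishes there, so that [z != x] yields the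
   strict inequality [F.[x] < 0] used below. *)
have [z xz [Fz Fx0]] : exists2 z, x <= z & root F z /\ (F.[x] = 0 -> z = x).
  have [Fx0|Fx0] := eqVneq F.[x] 0; first by exists x => //; split=> //; apply/rootP.
  by have [z xz Fz] := monic_root_ge F x monF Fx; exists z => //; split=> // /eqP; rewrite (negPf Fx0).
(* Removing [x] from the nodes and the root [z >= x] from [F] keeps the sign pattern. *)
have [F' eF] : exists F', F = F' * ('X - z%:P) by apply/factor_theorem.
have monF' : F' \is monic by move: monF; rewrite eF monicMr ?monicXsubC.
have szF' : size F = (size F').+1.
  by rewrite eF size_Mmonic ?monic_neq0 ?monicXsubC // size_XsubC addn2.
have [t et wt] : exists2 t, F' = prodX t & weave r t.
  apply: IHr => //; [exact: path_sorted xr | by move: szF; rewrite szF' => -[] [->]; [left|right] |] => y yr.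
  have yx := rx y yr; have := sgn y (@mem_behead _ (x :: r) _ yr).
  rewrite /= {1}/gt_than yx add1n exprS eF hornerM hornerXsubC.
  by nra.
exists (z :: t); first by rewrite big_cons -et eF mulrC.
move=> P upP /=; have := wt P upP.
(* If [P] contains both or neither of [x] and [z], the bounds carry over from [wt]. Since [x <= z],
   it cannot contain [x] alone, so the remaining case is [z] alone. *)
case Pz: (P z); case Px: (P x) => /=; try lia; last first.
  by move: Pz; rewrite (upP x).
have Pgt y : P y -> gt_than x y.
  by move=> Py; rewrite /gt_than ltNge; apply: contraFN Px => /upP; apply.
have r0 (Q : pred R) : (forall y, Q y -> gt_than x y) -> count Q r = 0%N.
  move=> Qgt; apply/eqP; rewrite -leqn0 leqNgt -has_count; apply/hasP => -[y yr].
  by move/Qgt; rewrite /gt_than ltNge ltW ?rx.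
(* Here [x < z]; by parity of the sign of [F'] at [x], [F'] has no root beyond [x]. *)
rewrite r0 //; have := wt _ (up_closed_gt x); rewrite r0 //.
have := sub_count Pgt t.
have F'x : 0 < F'.[x].
  have zx : z != x by apply: contraFneq Px => <-.
  have Fxlt : F.[x] < 0 by rewrite lt_neqAle Fx andbT; apply: contraNneq zx => /Fx0 ->.
  by move: Fxlt; rewrite eF hornerM hornerXsubC; nra.
have xt : x \notin t.
  by apply: contraL F'x => xt; rewrite -leNgt et; have := xt; rewrite -root_prod_XsubC => /rootP ->.
have := sign_prodX t x xt; rewrite -et.
case: (count (gt_than x) t) => [|[|n]]; last by lia.
  by rewrite leqn0 => _ /eqP ->.
by rewrite expr1; nra.
Qed.


(** * The linear combination at the zeros of [f], and removal of multiple zeros *)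

(** The term in [a] vanishes at [x]. By [weave_notin] each [prodX (s j)] not vanishing at [x] has
    the sign [e] there, so [e * F.[x]] is minus a sum of nonnegative terms, and a single positive
    one makes it nonzero. *)
Lemma comb_sign {R : realFieldType} (k : nat) (r : seq R) (a : {poly R})
    (b : 'I_k -> {poly R}) (c : 'I_k -> R) (s : 'I_k -> seq R) (x : R) :
  (forall j, 0 <= c j) -> (forall j, weave (s j) r) ->
  (forall j, (b j).[x] <= 0) -> x \in r ->
  let F := a * prodX r + \sum_(j < k) b j * (c j *: prodX (s j)) in
  (-1) ^+ count (gt_than x) r * F.[x] <= 0 /\
  ((exists2 j, c j != 0 /\ x \notin s j & (b j).[x] < 0) -> F.[x] != 0).
Proof.
move=> c0 w b0 xr F; set e := (-1) ^+ _.
have sg j : x \notin s j -> 0 < e * (prodX (s j)).[x].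
  by move=> xs; have := sign_prodX _ _ xs; rewrite (weave_notin _ _ _ (w j) xr xs).1.
have term_ge0 j : 0 <= - (b j).[x] * (c j * (e * (prodX (s j)).[x])).
  rewrite mulr_ge0 ?oppr_ge0 // mulr_ge0 //.
  have [xs|/sg/ltW //] := boolP (x \in s j).
  by move: xs; rewrite -root_prod_XsubC => /rootP ->; rewrite mulr0.
have eF : e * F.[x] = - \sum_(j < k) - (b j).[x] * (c j * (e * (prodX (s j)).[x])).
  have /rootP rx : root (prodX r) x by rewrite root_prod_XsubC.
  rewrite hornerD hornerM rx mulr0 add0r horner_sum mulr_sumr -sumrN.
  by apply: eq_bigr => j _; rewrite hornerM hornerZ; lra.
split; first by rewrite eF oppr_le0 sumr_ge0.
case=> j [cj xs] bj; suff: e * F.[x] != 0 by rewrite mulf_eq0 negb_or => /andP[].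
rewrite eF oppr_eq0 psumr_neq0 //; apply/hasP; exists j; first exact: mem_index_enum.
rewrite /= mulr_gt0 ?oppr_gt0 // mulr_gt0 ?(sg j xs) //.
by rewrite lt_neqAle eq_sym cj c0.
Qed.

Lemma comb_weave {R : rcfType} (k : nat) (r : seq R) (F a : {poly R})
    (b : 'I_k -> {poly R}) (c : 'I_k -> R) (s : 'I_k -> seq R) :
  F \is monic -> size F = (size r).+1 \/ size F = (size r).+2 ->
  F = a * prodX r + \sum_(j < k) b j * (c j *: prodX (s j)) ->
  (forall j, 0 <= c j) -> (forall j, weave (s j) r) ->
  (forall j, {in r, forall x, (b j).[x] <= 0}) ->
  exists2 t, F = prodX t & weave r t.
Proof.
have [n] := ubnP (size r); elim: n r F s => // n IHn r F s rn monF szF eF c0 w b0.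
have [ur|] := boolP (uniq r).
  (* Distinct nodes, put in strictly decreasing order as [alternating_signs_weave] requires. *)
  have pr : perm_eq (rev (sort <=%R r)) r by rewrite perm_rev perm_sort.
  have [||||t Ft wt] := alternating_signs_weave (rev (sort <=%R r)) F; last first.
  - by exists t => //; apply: perm_weave wt.
  - move=> x; rewrite mem_rev mem_sort => xr; rewrite (permP pr) eF.
    by have [] := comb_sign k r a b c s x c0 w (fun j => b0 j x xr) xr.
  - by rewrite size_rev size_sort.
  - by rewrite rev_sorted sort_lt_sorted.
  - by [].
move=> nu.
have [x xr] : exists x, (1 < count_mem x r)%N.
  have [/hasP[x _ xr]|/hasPn nr] := boolP (has (fun x => 1 < count_mem x r)%N r).
    by exists x.
  case/negP: nu; apply: count_mem_uniq => x.
  have := nr x; rewrite -has_pred1 has_count.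
  by case: (count_mem x r) => [|[|m]] //= /(_ isT).
have xinr : x \in r by rewrite -has_pred1 has_count; lia.
have xs j : x \in s j.
  by apply: contraLR xr => xs; rewrite (weave_notin _ _ _ (w j) xinr xs).2.
have prodX_rem (u : seq R) : x \in u -> prodX u = ('X - x%:P) * prodX (rem x u).
  by move=> /perm_to_rem xu; rewrite (perm_big _ xu) big_cons.
(* One factor ['X - x%:P] is cancelled from every product; [a], [b] and [c] stay the same, so the
   quotient is again a combination of the same form. *)
pose F' := a * prodX (rem x r) + \sum_(j < k) b j * (c j *: prodX (rem x (s j))).
have eF' : F = ('X - x%:P) * F'.
  rewrite eF (prodX_rem r) // mulrDr mulrCA; congr (_ + _).
  rewrite mulr_sumr; apply: eq_bigr => j _.
  by rewrite (prodX_rem (s j)) // scalerAr mulrCA.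
have szr : (size r = (size (rem x r)).+1)%N.
  by rewrite size_rem // prednK // -has_predT; apply/hasP; exists x.
have monF' : F' \is monic by move: monF; rewrite eF' monicMl ?monicXsubC.
have szF' : size F = (size F').+1.
  by rewrite eF' size_Mmonic ?monic_neq0 ?monicXsubC // size_XsubC.
have [|//||//|//||j y yr|t Ft wt] := IHn (rem x r) F' (fun j => rem x (s j)).
- by rewrite szr in rn.
- by rewrite szr szF' in szF; case: szF => -[->]; [left|right].
- by move=> j; apply: weave_rem.
- by apply: b0; apply: mem_rem yr.
exists (x :: t); first by rewrite big_cons -Ft.
by apply: perm_weave (perm_refl _) _; last apply/(weave_cons x); eauto; rewrite perm_sym perm_to_rem.
Qed.

(** * Passage between real-rooted polynomials and sorted lists of zeros *)

Lemma prodX_monic {R : nzRingType} (s : seq R) : prodX s \is monic.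
Proof. exact: monic_prod_XsubC. Qed.

Lemma zeros_of_prodX {R : realType} (c : R) (s : seq R) :
  c != 0 -> sorted >=%R s -> zeros_of (c *: prodX s) s.
Proof.
move=> c0 ss; split=> // x.
by rewrite -mul_polyC mupMr ?mu_prod_XsubC // rootC.
Qed.

Lemma RZ_prodX {R : realType} (c : R) (s : seq R) : RZ (c *: prodX s).
Proof.
move=> nz z; have c0 : c != 0 by apply: contraNneq nz => ->; rewrite scale0r.
rewrite linearZ /= rootZ ?fmorph_eq0 // rmorph_prod /=.
under eq_bigr do rewrite rmorphB /= map_polyX map_polyC /=.
rewrite -(big_map (real_complex R) predT (fun y => 'X - y%:P)) root_prod_XsubC.
by case/mapP => x _ ->.
Qed.

(** The polynomial splits over [complex R]; each root there is the image of its real part, and the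
    factorization descends by injectivity of the coefficient embedding. *)
Lemma RZ_split {R : realType} (p : {poly R}) : RZ p -> p != 0 ->
  exists2 s, sorted >=%R s & p = lead_coef p *: prodX s.
Proof.
move=> RZp p0; have [s es] := closed_field_poly_normal (map_poly (real_complex R) p).
have Ims : {in s, forall z, z = real_complex R (complex.Re z)}.
  move=> z zs; have : complex.Im z = 0.
    by apply: (RZp p0); rewrite es rootZ ?root_prod_XsubC // lead_coef_eq0 map_poly_eq0.
  by case: z {zs} => u v /= ->.
exists (sort >=%R [seq complex.Re z | z <- s]).
  by apply: sort_sorted => x y; exact: le_total.
apply: (map_poly_inj (real_complex R)); rewrite {1}es linearZ /= rmorph_prod /=.
rewrite lead_coef_map (perm_big _ (permEl (perm_sort _ _))) /= big_map.
congr (_ *: _); apply: eq_big_seq => z zs.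
by rewrite rmorphB /= map_polyX map_polyC /= -Ims.
Qed.

Lemma zeros_of_split {R : realType} (p : {poly R}) (s : seq R) :
  RZ p -> p != 0 -> zeros_of p s -> p = lead_coef p *: prodX s.
Proof.
move=> RZp p0 [ss ms]; have [t st ep] := RZ_split p RZp p0.
rewrite {1}ep; congr (_ *: _); apply: perm_big; apply/allP => x _ /=; apply/eqP.
by rewrite ms ep -mul_polyC mupMr ?mu_prod_XsubC // rootC lead_coef_eq0.
Qed.

Lemma size_scale_prodX {R : idomainType} (c : R) (s : seq R) :
  c != 0 -> size (c *: prodX s) = (size s).+1.
Proof. by move=> c0; rewrite size_scale // size_prod_XsubC. Qed.

Lemma chained_zeros_split {R : realType} (lt : rel R) (g f : {poly R}) :
  chained_zeros lt g f ->
  exists s r, [/\ sorted >=%R s, sorted >=%R r, chain lt s r,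
    g = lead_coef g *: prodX s & f = lead_coef f *: prodX r].
Proof.
case=> RZg RZf g0 f0 [s [r [zs zr c]]]; exists s, r.
by split; try exact: zeros_of_split; [case: zs | case: zr | ].
Qed.

Lemma chained_zeros_prodX {R : realType} (lt : rel R) (c d : R) (s r : seq R) :
  c != 0 -> d != 0 -> sorted >=%R s -> sorted >=%R r -> chain lt s r ->
  chained_zeros lt (c *: prodX s) (d *: prodX r).
Proof.
move=> c0 d0 ss sr csr; split; try exact: RZ_prodX.
- by rewrite scale_poly_eq0 negb_or c0 monic_neq0 ?prodX_monic.
- by rewrite scale_poly_eq0 negb_or d0 monic_neq0 ?prodX_monic.
by exists s, r; split=> //; apply: zeros_of_prodX.
Qed.

Lemma prec_noroot {R : realType} (g f : {poly R}) (x : R) :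
  prec g f -> root f x -> ~~ root g x.
Proof.
have aux : (size g <= size f)%N -> chained_zeros <%R g f -> root f x -> ~~ root g x.
  move=> sz gf; have [_ _ g0 f0 _] := gf.
  have [s [r [ss sr c eg ef]]] := chained_zeros_split _ g f gf.
  move: sz; rewrite eg ef !size_scale_prodX ?lead_coef_eq0 // ltnS.
  rewrite !rootZ ?lead_coef_eq0 // !root_prod_XsubC => sz.
  exact: strict_chain_notin.
by case=> -[sz]; apply: aux; rewrite sz.
Qed.

Lemma scale_prodX_inj {R : realType} (c d : R) (s t : seq R) :
  c != 0 -> c *: prodX s = d *: prodX t -> perm_eq s t.
Proof.
move=> c0 e; have d0 : d != 0.
  apply: contraNneq c0 => d0; move/eqP: e; rewrite d0 scale0r scale_poly_eq0.
  by rewrite (negPf (monic_neq0 (prodX_monic s))) orbF.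
apply/allP => x _ /=; rewrite -!mu_prod_XsubC.
move/(congr1 (mup x)): e; rewrite -!mul_polyC !mupMr ?rootC // => ->.
exact: eqxx.
Qed.

(** This absorbs the conventional cases of [preceq], so that only lists have to be handled
    afterwards. *)
Lemma preceq_weave {R : realType} (g : {poly R}) (c : R) (r : seq R) :
  c != 0 -> preceq g (c *: prodX r) ->
  exists s, g = lead_coef g *: prodX s /\ weave s r.
Proof.
move=> c0; set f := c *: prodX r.
have f0 : f != 0 by rewrite scale_poly_eq0 negb_or c0 monic_neq0 ?prodX_monic.
have aux : (size g <= size f <= (size g).+1)%N -> chained_zeros <=%R g f ->
    exists s, g = lead_coef g *: prodX s /\ weave s r.
  move=> sz gf; have [_ _ g0 _ _] := gf.
  have [s [r' [ss sr' csr eg ef]]] := chained_zeros_split _ g f gf.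
  exists s; split=> //; apply: (perm_weave s s r' r) => //.
    by rewrite perm_sym (scale_prodX_inj _ _ _ _ c0 ef).
  apply: chain_weave => //.
  by move: sz; rewrite eg ef !size_scale_prodX ?lead_coef_eq0.
case=> [[sz]|[sz]|u v w gu fv|_ /eqP|->].
- by apply: aux; rewrite sz leqnn leqnSn.
- by apply: aux; rewrite sz leqnn leqnSn.
(* A constant gets the empty list, and [f], of degree at most one, has at most one zero. *)
- exists [::]; rewrite gu lead_coefC big_nil alg_polyC; split=> //.
  apply: weave_nil; rewrite -ltnS -(size_scale_prodX c) // -/f fv.
  rewrite (leq_trans (size_polyD _ _)) // geq_max (leq_trans (size_scale_leq _ _)) ?size_polyX //.
  by rewrite (leq_trans (size_polyC_leq1 _)).
- by rewrite (negPf f0).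
(* For [g = 0] the coefficient is zero, so any list represents [g]; [r] weaves with itself. *)
by exists r; rewrite lead_coef0 scale0r; split=> //; apply: weavexx.
Qed.

(** * Normalization by the leading coefficient of [F], and the two conclusions *)

Theorem theorem2p3 (R : realType) (k : nat) (F f a : {poly R})
    (g b : 'I_k -> {poly R})
    (F_def : F = a * f + \sum_(j < k) b j * g j)
    (F_deg : size F = size f \/ size F = (size f).+1)
    (f_RZ : RZ f)
    (g_RZ : forall j, RZ (g j))
    (g_f : forall j, preceq (g j) f)
    (F_g_sign : same_lead_sign (F :: codom g))
    (b_le0 : forall j r, root f r -> (b j).[r] <= 0) :
  (RZ F /\ preceq f F) /\
  ((forall r, root f r -> exists2 j, prec (g j) f & (b j).[r] < 0) ->
   prec f F).
Proof.
have [f0|f0] := eqVneq f 0.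
  have F1 : (size F <= 1)%N by case: F_deg => ->; rewrite f0 size_poly0.
  have RZF : RZ F.
    move=> F0 z; rewrite (size1_polyC F1) map_polyC /= rootC fmorph_eq0.
    by move: F0; rewrite {1}(size1_polyC F1) polyC_eq0 => /negPf ->.
  split; first by split=> //; apply: Preceq_zero_left.
  (* Every number is a zero of the zero polynomial, so the strict hypothesis supplies some
     [prec (g j) f], which is impossible for [f = 0]. *)
  move=> /(_ 0); rewrite f0 root0 => /(_ isT)[j gf _].
  by case: gf => -[_ []]; rewrite eqxx.
have F0 : F != 0.
  by rewrite -size_poly_gt0; case: F_deg => ->; rewrite // size_poly_gt0.
have [r sr ef] := RZ_split f f_RZ f0.
have d0 : lead_coef f != 0 by rewrite lead_coef_eq0.
move: (lead_coef f) d0 ef => d d0 ef.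
have [L eL] : exists L, lead_coef F = L by eexists.
have L0 : L != 0 by rewrite -eL lead_coef_eq0.
have rf x : root f x = (x \in r) by rewrite ef rootZ // root_prod_XsubC.
have szf : size f = (size r).+1 by rewrite ef size_scale_prodX.
have [s hs] : exists s : 'I_k -> seq R, forall j,
    g j = lead_coef (g j) *: prodX (s j) /\ weave (s j) r.
  apply: (@fin_all_exists _ (fun=> seq R)
    (fun j u => g j = lead_coef (g j) *: prodX u /\ weave u r)) => j.
  by apply: (preceq_weave (g j) d r d0); rewrite -ef.
(* Dividing by [L] makes [F] monic, and the sign condition makes every [c j] nonnegative; a zero
   [g j] contributes [c j = 0]. *)
pose c j := L^-1 * lead_coef (g j).
have c0 j : 0 <= c j.
  rewrite /c; have [->|gj0] := eqVneq (g j) 0; first by rewrite lead_coef0 mulr0.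
  have := F_g_sign F (g j) _ _ F0 gj0; rewrite eL => sgE.
  rewrite -sgr_ge0 sgrM sgrV sgE ?mem_head ?inE ?codom_f ?orbT //.
  exact: sqr_ge0.
pose Fm := L^-1 *: F; pose a' := (L^-1 * d) *: a.
have eFm : Fm = a' * prodX r + \sum_(j < k) b j * (c j *: prodX (s j)).
  rewrite /Fm F_def scalerDr scaler_sumr; congr (_ + _).
    by rewrite /a' {1}ef -scalerA -!scalerAl -scalerAr.
  by apply: eq_bigr => j _; rewrite {1}(hs j).1 /c -scalerA !scalerAr.
have monFm : Fm \is monic by rewrite monicE lead_coefZ eL mulVf.
have szFm : size Fm = size F by rewrite size_scale ?invr_eq0.
have szF : size Fm = (size r).+1 \/ size Fm = (size r).+2 by rewrite szFm -szf.
have b0 j : {in r, forall x, (b j).[x] <= 0} by move=> x xr; apply: b_le0; rewrite rf.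
have w j := (hs j).2.
have [t0 eFt0 wt0] := comb_weave k r Fm a' b c s monFm szF eFm c0 w b0.
pose t := sort >=%R t0.
have st : sorted >=%R t by apply: sort_sorted => x y; exact: le_total.
have pt : perm_eq t0 t by rewrite perm_sym perm_sort.
have eF : F = L *: prodX t.
  by rewrite -(perm_big _ pt) -eFt0 /Fm scalerA mulfV // scale1r.
have wt : weave r t by apply: perm_weave wt0.
have crt := weave_chain _ _ sr st wt.
split; [split; first by rewrite eF; apply: RZ_prodX|].
  have cz : chained_zeros <=%R f F by rewrite ef eF; apply: chained_zeros_prodX.
  by case: F_deg => szE; [apply: Preceq_alternates | apply: Preceq_interlaces].
move=> hprec.
(* An equality in the weak chain would give [f] and [F] a common zero; the strict part of
   [comb_sign] excludes this. *)
have Fnz x : x \in r -> x \notin t.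
  move=> xr; have fx : root f x by rewrite rf.
  have [j gf bj] := hprec x fx; have := prec_noroot _ _ _ gf fx.
  have gj0 : lead_coef (g j) != 0 by rewrite lead_coef_eq0; case: gf => -[_ []].
  rewrite {1}(hs j).1 rootZ // root_prod_XsubC => xs.
  have [_ Fmx] := comb_sign k r a' b c s x c0 w (fun j => b0 j x xr) xr.
  rewrite -root_prod_XsubC -(perm_big _ pt) -eFt0 /root eFm; apply: Fmx.
  by exists j => //; split=> //; rewrite mulf_neq0 ?invr_eq0.
have cz : chained_zeros <%R f F.
  rewrite ef eF; apply: chained_zeros_prodX => //.
  case: crt => c1 c2; split=> i hi; rewrite lt_neqAle ?c1 ?c2 // andbT.
    (* The size bounds ensure that the compared entries are genuine zeros and not the default value
       0 of [nth]. *)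
    have it : (i < size t)%N by apply: leq_trans hi _; case/andP: (weave_size _ _ wt).
    by apply: contraNneq (Fnz _ (mem_nth 0 hi)) => ->; apply: mem_nth.
  have ir : (i < size r)%N.
    by rewrite -ltnS (leq_trans hi) //; case/andP: (weave_size _ _ wt).
  by apply: contraNneq (Fnz _ (mem_nth 0 ir)) => <-; apply: mem_nth.
by case: F_deg => szE; [left | right].
Qed.
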